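(* Let $\alpha,\beta\ge1$, let $(t_k)\subset(0,\infty)$ be a sequence tending to infinity and let $u_{t_k}$ be a minimizer of $E_{t_k}^{\alpha,\beta}(\cdot;f)$ for each $k$. Then $(u_{t_k})$ weakly$^*$ converges in $\mathcal X$ to $u_\infty:=\mathcal P^A(f)$ as $k\to\infty$.
   Context: Setting: $\mathcal X$ is the (real) Banach space dual of a separable Banach space $\mathcal Y$; $\mathcal H$ is a real Hilbert space; $A:\mathcal X\to\mathcal H$ is bounded and linear. $J:\mathcal X\to[0,\infty]$ is convex, proper, weak$^*$ lower semi-continuous and absolutely one-homogeneous ($J(cu)=|c|J(u)$). $\mathcal N(J)=\{u:J(u)=0\}$. The datum $f\in\mathcal H$ is such that any $u\in\mathcal X$ with $Au=f$ satisfies $J(u)\ne 0$. For $\alpha,\beta\ge1$, $t>0$: $E_t^{\alpha,\beta}(u;f)=\frac1\alpha\|Au-f\|_{\mathcal H}^\alpha+\frac t\beta J(u)^\beta$ for $u\in\mathcal X$. For $g\in\mathcal H$, $\mathcal P^A(g)\in\mathcal N(J)$ denotes the (unique) minimizer of $\|Au-g\|_{\mathcal H}$ over $u\in\mathcal N(J)$. Standing assumptions: (1) $u\mapsto\|Au\|_{\mathcal H}$ is a norm on $\mathcal N(J)$ equivalent to the restriction of $\|\cdot\|_{\mathcal X}$. (2) There is $C>0$ with $\|u-\mathcal P^A(Au)\|_{\mathcal X}\le C J(u)$ for all $u\in\mathcal X$. (3) $A$ is weak$^*$-to-weak continuous: $u_k\rightharpoonup^* u$ in $\mathcal X$ implies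 $Au_k\rightharpoonup Au$ in $\mathcal H$. *)

(* Defs.v *)
From HB Require Import structures.
From mathcomp Require Import all_boot all_order all_algebra sesquilinear.
From mathcomp Require Import all_classical all_reals all_analysis.

Set Implicit Arguments.
Unset Strict Implicit.
Unset Printing Implicit Defensive.

Import Order.TTheory GRing.Theory Num.Theory.
Import numFieldNormedType.Exports.

Local Open Scope classical_set_scope.
Local Open Scope ring_scope.

Section dual.
Context {R : realType} (Y : normedModType R).
Implicit Types f : Y -> R^o.

Definition continuous_linear : {pred (Y -> R^o)} :=
  [pred f | `[< linear f /\ continuous f >]].

Lemma continuous_linearP f :
  reflect (linear f /\ continuous f) (f \in continuous_linear).
Proof. exact: asboolP. Qed.

Lemma continuous_linear_submod : GRing.submod_closed continuous_linear.
Proof.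
split=> [|a f g /continuous_linearP[lf cf] /continuous_linearP[lg cg]].
  apply/continuous_linearP; split; last by move=> x; exact: cvg_cst.
  by move=> a x y; rewrite -[LHS]/(0 : R) -[_ *: 0 x]/(a * 0) mulr0 -[RHS]/(0 + 0 : R) addr0.
apply/continuous_linearP; split.
  move=> b x y; rewrite -[LHS]/(a *: f (b *: x + y) + g (b *: x + y)) lf lg
    -[RHS]/(b *: (a *: f x + g x) + (a *: f y + g y)) !scalerDr !scalerA (mulrC a b) !addrA.
  by congr (_ + _); rewrite addrAC.
by move=> x; apply: cvgD; [apply: cvgZr; exact: cf | exact: cg].
Qed.

HB.instance Definition _ := GRing.isSubmodClosed.Build R (Y -> R^o)
  continuous_linear continuous_linear_submod.

Record dual := Dual {
  dual_fun :> Y -> R^o;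
  _ : dual_fun \in continuous_linear }.

HB.instance Definition _ := [isSub for dual_fun].
HB.instance Definition _ := [Choice of dual by <:].
HB.instance Definition _ := [SubChoice_isSubLmodule of dual by <:].

Lemma dual_linear (u : dual) : linear u.
Proof. by have /continuous_linearP[] := valP u. Qed.

Lemma dual_continuous (u : dual) : continuous u.
Proof. by have /continuous_linearP[] := valP u. Qed.

HB.instance Definition _ (u : dual) :=
  GRing.isLinear.Build R Y R^o *:%R u (dual_linear u).

(* operator norm, sup of |u y| over the closed unit ball *)
Definition dual_norm (u : dual) : R :=
  sup [set `|u y| | y in [set y : Y | `|y| <= 1]].

Lemma dual_norm_has_sup (u : dual) :
  has_sup [set `|u y| | y in [set y : Y | `|y| <= 1]].
Proof.
split; first by exists `|u 0|, 0 => //=; rewrite normr0 ler01.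
have /linear_boundedP[M [_ uM]] : bounded_near u (nbhs (0 : Y)).
  apply: continuous_linear_bounded; exact: dual_continuous.
have := uM (`|M| + 1); rewrite (le_lt_trans (ler_norm M)) ?ltrDl// => /(_ isT) H.
exists (`|M| + 1) => _ [y /= y1 <-]; apply: (le_trans (H y)).
by rewrite -[leRHS]mulr1 ler_wpM2l// addr_ge0.
Qed.

Lemma dual_norm_ub (u : dual) (y : Y) : `|y| <= 1 -> `|u y| <= dual_norm u.
Proof.
by move=> y1; apply: ub_le_sup; [case: (dual_norm_has_sup u) | exists y].
Qed.

Lemma dual_norm_le (u : dual) (M : R) :
  (forall y : Y, `|y| <= 1 -> `|u y| <= M) -> dual_norm u <= M.
Proof.
move=> uM; apply: ge_sup; first by case: (dual_norm_has_sup u).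
by move=> _ [y y1 <-]; exact: uM.
Qed.

Lemma dual_normD (u v : dual) : dual_norm (u + v) <= dual_norm u + dual_norm v.
Proof.
apply: dual_norm_le => y y1; apply: (le_trans (ler_normD _ _)).
by apply: lerD; exact: dual_norm_ub.
Qed.

Lemma dual_normZ (a : R) (u : dual) : dual_norm (a *: u) = `|a| * dual_norm u.
Proof.
have le_normZ (b : R) v : dual_norm (b *: v) <= `|b| * dual_norm v.
  apply: dual_norm_le => y y1; rewrite -[(b *: v) y]/(b *: v y) normrZ.
  by rewrite ler_wpM2l// dual_norm_ub.
apply/eqP; rewrite eq_le le_normZ /=; have [->|a0] := eqVneq a 0.
  rewrite normr0 mul0r (le_trans (normr_ge0 ((0 *: u : dual) 0)))//.
  by rewrite dual_norm_ub// normr0 ler01.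
rewrite -ler_pdivlMl ?normr_gt0// -normfV -[in leLHS](scale1r u).
by rewrite -(mulVf a0) -scalerA.
Qed.

Lemma dual_norm0_eq0 (u : dual) : dual_norm u = 0 -> u = 0.
Proof.
move=> u0; apply/val_inj/funext => y; have [->|y0] := eqVneq y 0.
  by rewrite [LHS](linear0 u).
have : `|u (`|y|^-1 *: y)| <= 0.
  rewrite -u0 dual_norm_ub// normrZ normfV normr_id mulVf//.
  by rewrite normr_eq0.
rewrite normr_le0 linearZ /= scaler_eq0 invr_eq0 normr_eq0 (negbTE y0) /=.
by move/eqP.
Qed.

HB.instance Definition _ := Lmodule_isNormed.Build R dual
  dual_normD dual_normZ dual_norm0_eq0.

Definition weak_star :=
  initial_topology (fun u : dual => (u : Y -> R^o) : {ptws Y -> R^o}).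

HB.instance Definition _ := Topological.on weak_star.

End dual.

Definition weak {R : realType} (V : normedModType R) :=
  initial_topology
    (fun x : V => (fun phi : dual V => phi x) : {ptws dual V -> R^o}).

HB.instance Definition _ (R : realType) (V : normedModType R) :=
  Topological.on (weak V).

Definition weak_star_cvg {R : realType} {Y : normedModType R}
    (v : nat -> dual Y) (w : dual Y) :=
  (v : nat -> weak_star Y) @ \oo --> (w : weak_star Y).

Definition weak_cvg {R : realType} {V : normedModType R}
    (v : nat -> V) (w : V) :=
  (v : nat -> weak V) @ \oo --> (w : weak V).

Lemma cvg_initial {S : choiceType} {T : topologicalType} (g : S -> T)
    (v : nat -> S) (w : S) :
  (v : nat -> initial_topology g) @ \oo --> (w : initial_topology g) <->
  (g \o v) @ \oo --> g w.
Proof.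
split=> [vw|gvw B /=].
  exact: (@cvg_comp _ _ _ v g _ _ _ vw (@initial_continuous _ _ g w)).
rewrite nbhsE => -[_ [[C oC <-] /= Cgw] CB].
have /gvw : nbhs (g w) C by exact: open_nbhs_nbhs.
case=> N _ NC; exists N => // k /NC; exact: CB.
Qed.

Lemma weak_star_cvgP {R : realType} {Y : normedModType R}
    (v : nat -> dual Y) (w : dual Y) :
  weak_star_cvg v w <-> forall y, v k y @[k --> \oo] --> w y.
Proof.
apply: (iff_trans (cvg_initial (fun u : dual Y => (u : Y -> R^o)
  : {ptws Y -> R^o}) v w)).
exact: (@pointwise_cvgP Y R^o).
Qed.

Lemma weak_cvgP {R : realType} {V : normedModType R}
    (v : nat -> V) (w : V) :
  weak_cvg v w <-> forall phi : dual V, phi (v k) @[k --> \oo] --> phi w.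
Proof.
apply: (iff_trans (cvg_initial (fun x : V => (fun phi : dual V => phi x)
  : {ptws dual V -> R^o}) v w)).
exact: (@pointwise_cvgP (dual V) R^o).
Qed.

Definition weak_star_lsc {R : realType} {Y : normedModType R}
    (J : dual Y -> \bar R) :=
  @lower_semicontinuous (weak_star Y) R J.

Definition separable (T : topologicalType) :=
  exists2 D : set T, countable D & dense D.

(* completeness is not included *)
Definition hilbert_norm {R : realType} (H : normedModType R) :=
  exists dot : {dot H for idfun}, forall x, dot x x = `|x| ^+ 2.

(* [p] is meant to be a seminorm, so that definiteness makes it a norm on [D] *)
Definition equivalent_norm_on {R : realType} {X : normedModType R}
    (D : set X) (p : X -> R) :=
  (forall u, D u -> p u = 0 -> u = 0) /\
  exists c C : R, [/\ 0 < c, 0 < C &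
    forall u, D u -> c * `|u| <= p u <= C * `|u|].

Section functionals.
Context {R : realType} {X : lmodType R}.
Implicit Type J : X -> \bar R.
Local Open Scope ereal_scope.

(* at [s = 0] and [s = 1] the convention [0 * +oo = 0] of [\bar R] is used *)
Definition convex_ereal J := forall (u v : X) (s : R), (0 <= s <= 1)%R ->
  J (s *: u + (1 - s) *: v)%R <= s%:E * J u + (1 - s)%:E * J v.

Definition proper_ereal J := exists u, J u < +oo.

(* for [c = 0] this reads [J 0 = 0], since [0 * +oo = 0] in [\bar R] *)
Definition abs_one_homogeneous J :=
  forall (c : R) (u : X), J (c *: u)%R = `|c|%:E * J u.

Definition nullspace J : set X := [set u | J u = 0].

Definition energy {H : normedModType R} (A : X -> H) J (alpha beta t : R)
    (f : H) (u : X) : \bar R :=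
  (alpha^-1 * `|A u - f| `^ alpha)%:E + (t / beta)%:E * J u `^ beta.

Definition minimizer_on {T : Type} (D : set T) (F : T -> \bar R) (u : T) :=
  D u /\ forall v, D v -> F u <= F v.

(* [P^A(g)]; the default value [0] is only used when no minimizer exists *)
Definition PA {H : normedModType R} (A : X -> H) J (g : H) : X :=
  xget 0%R [set u | minimizer_on (nullspace J) (fun v => `|A v - g|%:E) u].

End functionals.

(* Main.v *)
Require Import Defs.
From HB Require Import structures.
From mathcomp Require Import all_boot all_order all_algebra sesquilinear.
From mathcomp Require Import all_classical all_reals all_analysis.
From mathcomp Require Import ring lra.

Set Implicit Arguments.
Unset Strict Implicit.
Unset Printing Implicit Defensive.

Import Order.TTheory GRing.Theory Num.Theory.
Import numFieldNormedType.Exports.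

Local Open Scope classical_set_scope.
Local Open Scope ring_scope.

(** The minimizers converge even in norm, as minimizing sequences of a
    projection problem do.

    Comparing [u k] with [0], where [J] vanishes, bounds
    [t k / beta * J (u k) `^ beta] by a constant, so [J (u k)] tends to [0]
    ([energy_minimizer_J_small]).  Comparing it with any [v] in the null space
    [N] of [J], where only the data term of the energy is left, gives
    [`|A (u k) - f| <= `|A v - f|] ([energy_minimizer_residual]).

    Let [p k] be the best approximation in [N] of [A (u k)].  The Poincare
    inequality bounds [`|u k - p k|] by a multiple of [J (u k)], so this
    distance tends to [0], and with it [A (u k) - A (p k)].  Hence the [p k],
    which lie in [N], minimize [`|A v - f|] over [N] up to errors that vanish in
    the limit.

    As in the proof of the projection theorem, the parallelogram law makes two
    nearly optimal elements of [N] close to each other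
    ([near_best_image_dist]), in the norm of the dual space because [A] is
    coercive on [N] ([near_best_close]).  So [p] is a Cauchy sequence.  It has a
    limit because a dual space is complete ([dual_cauchy_cvg]); the limit lies
    in [N] because [J] is weak* lower semicontinuous
    ([nullspace_weak_star_closed]), and it minimizes [`|A v - f|] over [N] by
    continuity of [A].  This proves that a minimizer exists, so that [PA A J f]
    is one rather than a default value, and [p] converges to it
    ([near_best_cvg]).  The sequence [u] has the same limit as [p]. *)

(** * Quadratic geometry of near-best approximation *)

Lemma hilbert_parallelogram (R : realType) (H : normedModType R)
    (hilbH : hilbert_norm H) (x y : H) :
  `|x - y| ^+ 2 + `|x + y| ^+ 2 = 2 * (`|x| ^+ 2 + `|y| ^+ 2).
Proof.
case: hilbH => dot dotE; rewrite -!dotE hnormB hnormD /=; ring.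
Qed.

Section near_best.
Context {R : realType} {X H : normedModType R} (A : {linear X -> H}).
Variables (D : set X) (f : H).

Definition near_best (e : R) (p : X) :=
  D p /\ forall v, D v -> `|A p - f| <= `|A v - f| + e.

Hypothesis hilbH : hilbert_norm H.
Hypothesis D0 : D 0.
Hypothesis DD : forall v w, D v -> D w -> D (v + w).
Hypothesis DZ : forall (a : R) v, D v -> D (a *: v).

(** Apply the parallelogram law to the two residuals: their half-sum is the
    residual of the midpoint of [p] and [q], which lies in [D] and therefore
    cannot be much smaller than either of them.  Comparing with [0] in [D] bounds
    the residuals by [`|f| + e], which makes the estimate uniform in [p], [q]. *)
Lemma near_best_image_dist (e : R) (p q : X) : 0 <= e ->
  near_best e p -> near_best e q ->
  `|A p - A q| ^+ 2 <= (8 * `|f| + 12 * e) * e.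
Proof.
move=> e0 [Dp pe] [Dq qe].
pose m := 2^-1 *: (p + q); have Dm : D m by apply/DZ/DD.
pose x := A p - f; pose y := A q - f; pose z := A m - f.
have xyB : A p - A q = x - y by rewrite /x /y opprB addrA subrK.
have xyD : x + y = 2 *: z.
  have Am : A m = 2^-1 *: (A p + A q) by rewrite linearZ linearD.
  rewrite /z Am scalerBr scalerA mulfV ?pnatr_eq0// scale1r.
  by rewrite /x /y scaler_nat mulr2n opprD addrACA.
have xz : `|x| <= `|z| + e by exact: pe.
have yz : `|y| <= `|z| + e by exact: qe.
have xf : `|x| <= `|f| + e by rewrite -[`|f|]normrN -sub0r -(linear0 A); exact: pe.
have yf : `|y| <= `|f| + e by rewrite -[`|f|]normrN -sub0r -(linear0 A); exact: qe.
have := ler_normD x y; rewrite xyD normrZ gtr0_norm// => zxy.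
have := hilbert_parallelogram hilbH x y.
rewrite xyD normrZ gtr0_norm// exprMn -xyB => par.
have x0 := normr_ge0 x; have y0 := normr_ge0 y; have z0 := normr_ge0 z.
have x2 : `|x| ^+ 2 <= (`|z| + e) ^+ 2 by rewrite lerXn2r// ?nnegrE// addr_ge0.
have y2 : `|y| ^+ 2 <= (`|z| + e) ^+ 2 by rewrite lerXn2r// ?nnegrE// addr_ge0.
have ze : `|z| * e <= (`|f| + e) * e by rewrite ler_wpM2r//; lra.
nra.
Qed.

(** This one modulus serves twice: it makes minimizing sequences Cauchy, and it
    makes them converge to any given minimizer, which is near-best for every
    [e > 0]. *)
Lemma near_best_close (c : R) : 0 < c ->
  (forall v, D v -> c * `|v| <= `|A v|) ->
  forall d : R, 0 < d -> exists2 e, 0 < e &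
    forall p q, near_best e p -> near_best e q -> `|p - q| <= d.
Proof.
move=> c0 cA d d0; pose M := 8 * `|f| + 12.
have M0 : 0 < M by rewrite ltr_wpDl// mulr_ge0.
(* [e <= 1] turns the quadratic bound of near_best_image_dist into [M * e] *)
pose e := Num.min 1 ((c * d) ^+ 2 / M).
have e0 : 0 < e by rewrite lt_min ltr01 divr_gt0// exprn_gt0// mulr_gt0.
exists e => // p q pe qe.
have Dpq : D (p - q) by rewrite -scaleN1r; apply: DD (pe.1) (DZ _ (qe.1)).
have e1 : e <= 1 by rewrite ge_min lexx.
have eM : M * e <= (c * d) ^+ 2 by rewrite mulrC -ler_pdivlMr// ge_min lexx orbT.
have := near_best_image_dist (ltW e0) pe qe.
have : (8 * `|f| + 12 * e) * e <= M * e by rewrite ler_wpM2r ?(ltW e0)// /M; lra.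
move=> h1 h2; rewrite -(ler_pM2l c0) (le_trans (cA _ Dpq))// linearB.
rewrite -ler_sqr ?nnegrE ?normr_ge0//; last by rewrite mulr_ge0 ?ltW.
by rewrite (le_trans h2)// (le_trans h1).
Qed.

End near_best.

(** * Norm convergence in the dual space *)

Section dual_norm_topology.
Context {R : realType} {Y : normedModType R}.

Lemma dual_eval_le (u : dual Y) (y : Y) : `|u y| <= `|u| * `|y|.
Proof.
have [->|y0] := eqVneq y 0; first by rewrite linear0 !normr0 mulr0.
have ny0 : 0 < `|y| by rewrite normr_gt0.
have : `|u (`|y|^-1 *: y)| <= `|u|.
  by apply: dual_norm_ub; rewrite normrZ normfV normr_id mulVf// gt_eqF.
by rewrite linearZ normrZ normfV normr_id ler_pdivrMl// mulrC.
Qed.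

Lemma norm_cvg_weak_star (v : nat -> dual Y) (w : dual Y) :
  v @ \oo --> w -> weak_star_cvg v w.
Proof.
move=> vw; apply/weak_star_cvgP => y; apply/cvgrPdist_le => e e0.
have y1 : 0 < `|y| + 1 by rewrite ltr_wpDl.
have ey : 0 < e / (`|y| + 1) by rewrite divr_gt0.
have /cvgrPdist_le/(_ _ ey) := vw; apply: filterS => k wv.
rewrite -[X in `|X|]/((w - v k) y) (le_trans (dual_eval_le _ _))//.
move: wv; rewrite ler_pdivlMr//; apply: le_trans.
by rewrite ler_wpM2l// lerDl.
Qed.

(** The limit is built pointwise.  The Cauchy estimate passes to the pointwise
    limit with a bound [d * `|y|] that is uniform on the unit ball; this gives
    both the continuity of the limit, by comparison with a single [p N], and the
    convergence in norm. *)
Lemma dual_cauchy_cvg (p : nat -> dual Y) :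
  (forall d : R, 0 < d -> exists N, forall k l, (N <= k)%N -> (N <= l)%N ->
    `|p k - p l| <= d) ->
  exists q : dual Y, p @ \oo --> q.
Proof.
move=> pC.
have pCy k l y (d : R) : `|p k - p l| <= d -> `|p k y - p l y| <= d * `|y|.
  by move=> /(ler_wpM2r (normr_ge0 y)); exact/le_trans/(dual_eval_le (p k - p l)).
have pyC y : cvg (p k y @[k --> \oo]).
  apply/cauchy_cvgP/cauchy_exP => e e0.
  have y1 : 0 < `|y| + 1 by rewrite ltr_wpDl.
  have [N NP] := pC _ (divr_gt0 e0 y1).
  exists (p N y); exists N => // k /= Nk.
  rewrite -ball_normE /= (le_lt_trans (pCy _ _ y _ (NP _ _ (leqnn N) Nk)))//.
  by rewrite mulrAC ltr_pdivrMr// ltr_pM2l// ltrDl.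
pose q0 y : R^o := lim (p k y @[k --> \oo]).
have pq d : 0 < d -> exists N, forall k, (N <= k)%N ->
    forall y, `|p k y - q0 y| <= d * `|y|.
  move=> /pC[N NP]; exists N => k Nk y.
  have pkq : `|p k y - p l y| @[l --> \oo] --> `|p k y - q0 y|.
    by apply: cvg_norm; apply: cvgB; [exact: cvg_cst | exact: pyC].
  rewrite -(cvg_lim _ pkq)//; apply: limr_le; first exact: cvgP pkq.
  by exists N => // l /= Nl; exact/pCy/NP.
have q0_linear : linear q0.
  move=> a x y; apply: cvg_lim => //.
  under eq_cvg do rewrite linearP.
  by apply: cvgD; [apply: cvgZr; exact: pyC | exact: pyC].
pose q1 : {linear Y -> R^o} :=
  HB.pack q0 (GRing.isLinear.Build R Y R^o *:%R q0 q0_linear).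
have q0_continuous : continuous q0.
  have [N NP] := pq _ ltr01.
  apply: (@bounded_linear_continuous _ _ _ q1).
  apply/linear_boundedP; exists (`|p N| + 1); split=> // M NM y.
  rewrite -[q1 y](subKr (p N y)) (le_trans (ler_normB _ _))//.
  rewrite (le_trans (lerD (dual_eval_le _ _) (NP _ (leqnn N) y)))//.
  by rewrite -mulrDl ler_wpM2r// ltW.
have q0P : q0 \in @continuous_linear R Y by apply/continuous_linearP.
exists (Dual q0P); apply/cvgrPdist_le => e e0.
have [N NP] := pq _ e0; exists N => // k /= Nk; rewrite distrC.
apply: dual_norm_le => y y1; apply: (le_trans (NP _ Nk y)).
by rewrite -[leRHS]mulr1 ler_wpM2l// ltW.
Qed.

End dual_norm_topology.

(** * The null space and its best approximations *)

Section nullspace.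
Context {R : realType} {X : lmodType R} (J : X -> \bar R).
Hypothesis J_ge0 : forall u, (0 <= J u)%E.
Hypothesis J_homogeneous : abs_one_homogeneous J.

Lemma nullspaceZ (a : R) v : nullspace J v -> nullspace J (a *: v).
Proof. by rewrite /nullspace /= J_homogeneous => ->; rewrite mule0. Qed.

Lemma nullspace0 : nullspace J 0.
Proof. by rewrite /nullspace /= -(scale0r 0) J_homogeneous normr0 mul0e. Qed.

(** The midpoint is in the null space by convexity, and its double by
    homogeneity. *)
Lemma nullspaceD (J_convex : convex_ereal J) v w :
  nullspace J v -> nullspace J w -> nullspace J (v + w).
Proof.
move=> Jv Jw.
have half : 0 <= (2^-1 : R) <= 1 by lra.
have := J_convex v w _ half; rewrite Jv Jw !mule0 adde0.
have -> : 1 - 2^-1 = 2^-1 :> R by lra.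
rewrite -scalerDr => Jm.
have Jm0 : nullspace J (2^-1 *: (v + w)) by apply/eqP; rewrite eq_le Jm J_ge0.
by have := nullspaceZ 2 Jm0; rewrite scalerA mulfV ?pnatr_eq0// scale1r.
Qed.

(** This holds whether or not a minimizer exists: the default value [0] is in the
    null space too. *)
Lemma PA_nullspace {H : normedModType R} (A : X -> H) (g : H) :
  nullspace J (PA A J g).
Proof. by rewrite /PA; case: xgetP => [_ _ []//|_]; exact: nullspace0. Qed.

End nullspace.

(** If [J q > 0], lower semicontinuity would make [J] positive on a weak*
    neighbourhood of [q], which contains almost all [p k]. *)
Lemma nullspace_weak_star_closed {R : realType} {Y : normedModType R}
    (J : dual Y -> \bar R) (J_ge0 : forall u, (0 <= J u)%E)
    (J_lsc : weak_star_lsc J) (p : nat -> dual Y) (q : dual Y) :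
  weak_star_cvg p q -> (\forall k \near \oo, nullspace J (p k)) ->
  nullspace J q.
Proof.
move=> pq Jp; apply/eqP; rewrite eq_le J_ge0 andbT leNgt; apply/negP => Jq.
have [V qV JV] := J_lsc q 0 Jq.
have [N _ NP] : \forall k \near \oo, nullspace J (p k) /\ V (p k).
  by apply: filterI => //; exact: pq.
by have [Jp0 /JV] := NP N (leqnn N); rewrite Jp0 ltxx.
Qed.

Section near_best_limit.
Context {R : realType} {Y H : normedModType R} (A : {linear dual Y -> H}).
Variables (J : dual Y -> \bar R) (f : H) (c M : R).
Hypothesis hilbH : hilbert_norm H.
Hypothesis J_ge0 : forall u, (0 <= J u)%E.
Hypothesis J_convex : convex_ereal J.
Hypothesis J_lsc : weak_star_lsc J.
Hypothesis J_homogeneous : abs_one_homogeneous J.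
Hypothesis A_bounded : forall u, `|A u| <= M * `|u|.
Hypothesis c_gt0 : 0 < c.
Hypothesis A_coercive : forall u, nullspace J u -> c * `|u| <= `|A u|.

(** The existence of a minimizer is part of the proof: it is the limit of [p]. *)
Lemma near_best_cvg (p : nat -> dual Y) :
  (forall e : R, 0 < e ->
     \forall k \near \oo, near_best A (nullspace J) f e (p k)) ->
  p @ \oo --> PA A J f.
Proof.
move=> pN.
have close := near_best_close f hilbH (nullspace0 J_homogeneous)
  (nullspaceD J_ge0 J_homogeneous J_convex) (nullspaceZ J_homogeneous)
  c_gt0 A_coercive.
have [q pq] : exists q : dual Y, p @ \oo --> q.
  apply: dual_cauchy_cvg => d /close[e e0 eP].
  have [N _ NP] := pN _ e0.
  by exists N => k l Nk Nl; apply: eP; exact: NP.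
have A_continuous : continuous A.
  apply: bounded_linear_continuous; apply/linear_boundedP; exists M; split=> [|N MN v]; first exact: num_real.
  by rewrite (le_trans (A_bounded v))// ler_wpM2r// ltW.
have Apq : A (p k) @[k --> \oo] --> A q.
  exact: (cvg_comp p A pq (A_continuous q)).
have Jq : nullspace J q.
  apply: (nullspace_weak_star_closed J_ge0 J_lsc (norm_cvg_weak_star pq)).
  by apply: filterS (pN _ ltr01) => k [].
have q_min : minimizer_on (nullspace J) (fun v => `|A v - f|%:E) q.
  split=> // v Jv; rewrite lee_fin; apply/ler_addgt0Pr => e e0.
  have Apqf : `|A (p k) - f| @[k --> \oo] --> `|A q - f|.
    by apply: cvg_norm; apply: cvgB => //; exact: cvg_cst.
  rewrite -(cvg_lim _ Apqf)//; apply: limr_le; first exact: cvgP Apqf.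
  by apply: filterS (pN _ e0) => k [_]; apply.
have [JP Pmin] : minimizer_on (nullspace J) (fun v => `|A v - f|%:E) (PA A J f).
  by apply: xgetPex; exists q.
apply/cvgrPdist_le => d /close[e e0 eP].
apply: filterS (pN _ e0) => k; apply: eP; split=> // v /Pmin.
by rewrite lee_fin => /le_trans; apply; rewrite lerDl ltW.
Qed.

End near_best_limit.

(** * Minimizers of the energy for large regularization parameter *)

Section energy_minimizers.
Context {R : realType} {X H : normedModType R} (A : {linear X -> H}).
Variables (J : X -> \bar R) (f : H) (alpha beta : R).
Hypothesis J_ge0 : forall u, (0 <= J u)%E.
Hypothesis alpha_ge1 : 1 <= alpha.
Hypothesis beta_ge1 : 1 <= beta.

Let alpha_gt0 : 0 < alpha. Proof. exact: lt_le_trans alpha_ge1. Qed.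
Let beta_gt0 : 0 < beta. Proof. exact: lt_le_trans beta_ge1. Qed.

Lemma energy_nullspace (t : R) v : nullspace J v ->
  energy A J alpha beta t f v = (alpha^-1 * `|A v - f| `^ alpha)%:E.
Proof.
by rewrite /nullspace /energy /= => ->; rewrite poweR0r ?gt_eqF// mule0 adde0.
Qed.

Lemma energy_minimizer_residual (t : R) (u v : X) : 0 < t ->
  minimizer_on setT (energy A J alpha beta t f) u -> nullspace J v ->
  `|A u - f| <= `|A v - f|.
Proof.
move=> t0 [_ /(_ v I) uv] Jv; rewrite (energy_nullspace t Jv) in uv.
have : ((alpha^-1 * `|A u - f| `^ alpha)%:E <=
        (alpha^-1 * `|A v - f| `^ alpha)%:E)%E.
  apply: le_trans uv; rewrite /energy leeDl//.
  by rewrite mule_ge0 ?poweR_ge0// lee_fin divr_ge0 ?ltW.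
rewrite lee_fin ler_pM2l ?invr_gt0// leNgt => uvN; rewrite leNgt.
by apply: contra uvN => vu; rewrite gt0_ltr_powR// nnegrE.
Qed.

(** If [J u] exceeds [e], the penalty alone is at least [t / beta * e `^ beta],
    which for large [t] is more than the energy at [0]. *)
Lemma energy_minimizer_J_small (J0 : nullspace J 0) (e : R) : 0 < e ->
  exists T : R, forall t u, T < t -> 0 < t ->
    minimizer_on setT (energy A J alpha beta t f) u -> (J u <= e%:E)%E.
Proof.
move=> e0; pose K := alpha^-1 * `|A 0 - f| `^ alpha.
have eb : 0 < e `^ beta by rewrite powR_gt0.
exists (K * beta / e `^ beta) => t u Tt t0 [_ /(_ 0 I)].
rewrite (energy_nullspace t J0) -/K leNgt => uN; rewrite leNgt.
apply: contra uN => eJ.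
have : (e%:E `^ beta <= J u `^ beta)%E.
  apply: gt0_ler_poweR; rewrite ?ltW// in_itv /= ?leey ?andbT//.
  by rewrite lee_fin ltW.
have tb : 0 < t / beta by rewrite divr_gt0.
move=> eJb; rewrite /energy.
apply: (@lt_le_trans _ _ ((t / beta)%:E * J u `^ beta)%E).
  apply: (@lt_le_trans _ _ ((t / beta)%:E * (e%:E `^ beta))%E).
    rewrite poweR_EFin -EFinM lte_fin mulrAC ltr_pdivlMr//.
    by rewrite -ltr_pdivrMr.
  by rewrite lee_pmul2l.
by rewrite leeDr// lee_fin mulr_ge0 ?powR_ge0// invr_ge0 ltW.
Qed.

End energy_minimizers.

Theorem theorem2p13 (R : realType)
  (Y : completeNormedModType R) (sepY : separable Y)
  (H : completeNormedModType R) (hilbH : hilbert_norm H)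
  (A : {linear dual Y -> H})
  (A_bounded : exists M : R, forall u, `|A u| <= M * `|u|)
  (J : dual Y -> \bar R)
  (J_ge0 : forall u, (0 <= J u)%E)
  (J_convex : convex_ereal J)
  (J_proper : proper_ereal J)
  (J_lsc : weak_star_lsc J)
  (J_homogeneous : abs_one_homogeneous J)
  (f : H)
  (f_datum : forall u, A u = f -> J u <> 0%E)
  (normA : equivalent_norm_on (nullspace J) (fun u => `|A u|))
  (poincare : exists2 C : R, 0 < C &
    forall u, (`|u - PA A J (A u)|%:E <= C%:E * J u)%E)
  (A_weak_continuous : forall (v : nat -> dual Y) (w : dual Y),
    weak_star_cvg v w -> weak_cvg (A \o v) (A w))
  (alpha beta : R) (alpha_ge1 : 1 <= alpha) (beta_ge1 : 1 <= beta)
  (t : nat -> R) (t_gt0 : forall k, 0 < t k) (t_infty : t @ \oo --> +oo)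
  (u : nat -> dual Y)
  (u_min : forall k, minimizer_on setT (energy A J alpha beta (t k) f) (u k)) :
  weak_star_cvg u (PA A J f).
Proof.
case: A_bounded => M A_M; case: poincare => C C0 PAC.
have [_ [c [C2 [c0 _ cA]]]] := normA.
have J0 := nullspace0 J_homogeneous.
pose p k := PA A J (A (u k)).
have Jp k : nullspace J (p k) by exact: PA_nullspace.
have up e : 0 < e -> \forall k \near \oo, `|u k - p k| <= e.
  move=> e0.
  have [T TP] := energy_minimizer_J_small A f J_ge0 alpha_ge1 beta_ge1 J0
    (divr_gt0 e0 C0).
  have /cvgryPgt/(_ T) := t_infty; apply: filterS => k Tt.
  rewrite -lee_fin (le_trans (PAC _))//.
  have -> : e = C * (e / C) by rewrite mulrCA mulfV ?mulr1// gt_eqF.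
  by rewrite EFinM lee_pmul2l// (TP (t k)).
have pN e : 0 < e ->
    \forall k \near \oo, near_best A (nullspace J) f e (p k).
  move=> e0; have M1 : 0 < `|M| + 1 by rewrite ltr_wpDl.
  apply: filterS (up _ (divr_gt0 e0 M1)) => k upk; split=> // v Jv.
  have uv := energy_minimizer_residual alpha_ge1 beta_ge1 (t_gt0 k)
    (u_min k) Jv.
  have -> : A (p k) - f = (A (u k) - f) - A (u k - p k).
    by rewrite linearB opprB [RHS]addrC addrA subrK.
  rewrite (le_trans (ler_normB _ _))// lerD// (le_trans (A_M _))//.
  rewrite (@le_trans _ _ ((`|M| + 1) * `|u k - p k|))//.
    by rewrite ler_wpM2r// (le_trans (ler_norm M))// lerDl.
  by rewrite mulrC -ler_pdivlMr.
have pP : p @ \oo --> PA A J f.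
  apply: (near_best_cvg hilbH J_ge0 J_convex J_lsc J_homogeneous A_M c0) pN.
  by move=> v /cA /andP[].
have up0 : (u k - p k) @[k --> \oo] --> (0 : dual Y).
  apply/cvgrPdist_le => e /up; apply: filterS => k.
  by rewrite sub0r normrN.
apply: norm_cvg_weak_star; rewrite -[PA A J f]add0r.
rewrite (_ : u = (fun k => (u k - p k) + p k)).
  exact: cvgD.
by apply/funext => k; rewrite subrK.
Qed.
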